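(* Let $(\Omega,\mathcal{F})$ be a measurable space, let $m\ge 2$, and let $k,n$ be positive integers with $k\le m$. Let $\mathcal{P}=\sum_{i=1}^m a_i\delta_{\mu_i}$ be a mixture of measures (with $m$ distinct components $\mu_1,\dots,\mu_m$, all weights $a_i>0$) such that $\mu_1,\dots,\mu_m$ are $k$-independent. If $2m-1\le (k-1)n$, then $\mathcal{P}$ is $n$-identifiable.
   Context: Let $\mathcal{D}$ be the set of probability measures on the measurable space $(\Omega,\mathcal{F})$, viewed as a subset of the real vector space of finite signed measures on $(\Omega,\mathcal{F})$, and equip $\mathcal{D}$ with its power-set $\sigma$-algebra. A mixture of measures is a probability measure on $\mathcal{D}$ of the form $\mathcal{P}=\sum_{i=1}^m a_i\delta_{\mu_i}$, where $m<\infty$, $\mu_i\in\mathcal{D}$, $a_i>0$, $\sum_{i=1}^m a_i=1$, and $\delta_{\mu}$ is the Dirac measure at $\mu$. Representations are always taken minimal, i.e. the $\mu_i$ are pairwise distinct; the $\mu_i$ are called the (mixture) components and $m$ is the number of components. Two mixtures of measures are equal when they are equal as measures on $\mathcal{D}$. For a positive integer $n$, define $V_n(\mathcal{P})=\sum_{i=1}^m a_i\mu_i^{\times n}$, a probability measure on $(\Omega^{n},\mathcal{F}^{\times n})$ (product $\sigma$-algebra), where $\mu_i^{\times n}$ is the $n$-fold product measure. A mixture of measures $\mathcal{P}$ with $m$ components is $n$-identifiable if there is no mixture of measures $\mathcal{P}'\ne\mathcal{P}$ on the same space with $m$ or fewer components such that $V_n(\mathcal{P}')=V_n(\mathcal{P})$.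 A sequence of vectors $x_1,\dots,x_m$ in a vector space is $k$-independent (where $k\le m$) if every subsequence consisting of $k$ of the vectors is linearly independent. *)

(* Defs.v *)
From HB Require Import structures.
From mathcomp Require Import all_boot all_order all_algebra.
From mathcomp Require Import all_classical all_reals all_analysis.

Set Implicit Arguments.
Unset Strict Implicit.
Unset Printing Implicit Defensive.
Import Order.TTheory GRing.Theory Num.Theory.
Import numFieldNormedType.Exports.
Local Open Scope classical_set_scope.
Local Open Scope ring_scope.

Definition linearly_independent (R : pzRingType) (V : lmodType R) (k : nat)
    (v : 'I_k -> V) :=
  forall c : 'I_k -> R, \sum_(i < k) c i *: v i = 0 -> forall i, c i = 0.

(* [s] enumerates the indices of a subsequence of length [k]. *)
Definition k_independent (R : pzRingType) (V : lmodType R) (k m : nat)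
    (v : 'I_m -> V) :=
  forall s : 'I_k -> 'I_m, {homo s : i j / (i < j)%N} ->
    linearly_independent (v \o s).

(* Library measures are functions on all subsets of [T], and nothing is
   required of their values on non-measurable sets. Two of them that are the
   same measure on the sigma-algebra may thus differ as functions. Below, the
   measures are required to vanish on non-measurable sets, so that Leibniz
   equality is equality of measures ([signed_measureP], [prob_measureP]) and no
   measure is lost ([restrict_prob]). *)

Section signed_measure.
Context {d : measure_display} (T : measurableType d) (R : realType).

Definition is_signed_measure : {pred set T -> R} := [pred f |
  `[< [/\ f set0 = 0, semi_sigma_additive (EFin \o f) &
          forall A, ~ measurable A -> f A = 0] >]].

Lemma is_signed_measureP (f : set T -> R) :
  reflect [/\ f set0 = 0, semi_sigma_additive (EFin \o f) &
              forall A, ~ measurable A -> f A = 0]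
          (f \in is_signed_measure).
Proof. by rewrite inE; exact: asboolP. Qed.

Let is_signed_measure_closed : submod_closed is_signed_measure.
Proof.
split.
  apply/is_signed_measureP; split=> // F mF tF mUF.
  rewrite [X in X @ _ --> _](_ : _ = cst 0%E); first exact: cvg_cst.
  by apply/funext => n; rewrite big1.
move=> a f g /is_signed_measureP[f0 sf zf] /is_signed_measureP[g0 sg zg].
have E A : (a *: f + g) A = a * f A + g A by [].
apply/is_signed_measureP; split.
- by rewrite E f0 g0 mulr0 addr0.
- move=> F mF tF mUF.
  have cf := sf _ mF tF mUF; have cg := sg _ mF tF mUF.
  rewrite [X in X @ _ --> _](_ : _ = fun n =>
    (a%:E * \sum_(0 <= i < n) (f (F i))%:E
     + \sum_(0 <= i < n) (g (F i))%:E)%E); last first.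
    apply/funext => n; rewrite !sumEFin -EFinM -EFinD mulr_sumr -big_split/=.
    by [].
  rewrite [X in _ --> X](_ : _ = (a%:E * (f (\bigcup_n F n))%:E
    + (g (\bigcup_n F n))%:E)%E)//.
  apply: cvgeD => //; exact: cvgeZl.
- by move=> A nA; rewrite E zf// zg// mulr0 addr0.
Qed.

HB.instance Definition _ := GRing.isSubmodClosed.Build _ _ is_signed_measure
  is_signed_measure_closed.

Record signed_measure := SignedMeasure {
  signed_measure_fun :> set T -> R;
  signed_measure_subproof : signed_measure_fun \in is_signed_measure }.

HB.instance Definition _ := [isSub for signed_measure_fun].
HB.instance Definition _ := [Choice of signed_measure by <:].
HB.instance Definition _ := [SubChoice_isSubLmodule of signed_measure by <:].

Lemma signed_measureP (mu nu : signed_measure) :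
  mu = nu <-> forall A, measurable A -> mu A = nu A.
Proof.
split=> [->//|munu]; apply/val_inj/funext => A /=.
have [/munu//|nA] := pselect (measurable A).
have /is_signed_measureP[_ _ ->//] := signed_measure_subproof mu.
by have /is_signed_measureP[_ _ ->] := signed_measure_subproof nu.
Qed.

End signed_measure.

Section prob_measure.
Context {d : measure_display} (T : measurableType d) (R : realType).

Record prob_measure := ProbMeasure {
  prob_measure_prob :> probability T R;
  prob_measure_out : forall A, ~ measurable A -> prob_measure_prob A = 0%E }.

Lemma prob_measureP (mu nu : prob_measure) :
  mu = nu <-> forall A, measurable A -> mu A = nu A.
Proof.
split=> [->//|]; case: mu nu => [mu mu0] [nu nu0] /= munu.
have E : (mu : set T -> \bar R) = nu.
  apply/funext => A; have [/munu//|nA] := pselect (measurable A).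
  by rewrite mu0// nu0.
have {}E : mu = nu.
  case: mu nu E {mu0 nu0 munu} =>
    [f [[f1 f2] [f3] [f4] [f5] [f6] [f7] [f8]]].
  case=> [g [[+ +] [+] [+] [+] [+] [+] [+]]] /= fg.
  case: _ / fg => g1 g2 g3 g4 g5 g6 g7 g8.
  by rewrite (Prop_irrelevance f1 g1) (Prop_irrelevance f2 g2)
    (Prop_irrelevance f3 g3) (Prop_irrelevance f4 g4) (Prop_irrelevance f5 g5)
    (Prop_irrelevance f6 g6) (Prop_irrelevance f7 g7) (Prop_irrelevance f8 g8).
by case: _ / E nu0 => nu0; rewrite (Prop_irrelevance mu0 nu0).
Qed.

Definition restrict (mu : probability T R) : set T -> \bar R :=
  fun A => if pselect (measurable A) then mu A else 0%E.

Section restrict.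
Variable mu : probability T R.

Let restrictE A : measurable A -> restrict mu A = mu A.
Proof. by move=> mA; rewrite /restrict; case: (pselect (measurable A)). Qed.

Let restrict_out A : ~ measurable A -> restrict mu A = 0%E.
Proof. by move=> mA; rewrite /restrict; case: (pselect (measurable A)). Qed.

Let restrict0 : restrict mu set0 = 0%E.
Proof. by rewrite restrictE. Qed.

Let restrict_ge0 A : (0 <= restrict mu A)%E.
Proof.
by have [/restrictE->|/restrict_out->] := pselect (measurable A).
Qed.

Let restrict_sigma_additive : semi_sigma_additive (restrict mu).
Proof.
move=> F mF tF mUF; rewrite restrictE//.
under eq_fun do under eq_bigr do rewrite restrictE//.
exact: measure_semi_sigma_additive.
Qed.

HB.instance Definition _ := isMeasure.Build _ _ _ (restrict mu)
  restrict0 restrict_ge0 restrict_sigma_additive.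

Let restrict_setT : restrict mu setT = 1%E.
Proof. by rewrite restrictE// probability_setT. Qed.

HB.instance Definition _ := Measure_isProbability.Build _ _ _ (restrict mu)
  restrict_setT.

Definition restrict_prob : prob_measure := ProbMeasure restrict_out.

Lemma restrict_probE A : measurable A -> restrict_prob A = mu A.
Proof. exact: restrictE. Qed.

End restrict.

HB.instance Definition _ := gen_eqMixin prob_measure.
HB.instance Definition _ := gen_choiceMixin prob_measure.
HB.instance Definition _ :=
  isPointed.Build prob_measure (restrict_prob (dirac point)).
HB.instance Definition _ := @isMeasurable.Build default_measure_display
  prob_measure discrete_measurable discrete_measurable0
  discrete_measurableC discrete_measurableU.

Lemma prob_measure_measurable (A : set prob_measure) : measurable A.
Proof. by []. Qed.

Let signed_of_prob_subproof (mu : prob_measure) :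
  (fun A => fine (mu A)) \in @is_signed_measure d T R.
Proof.
apply/is_signed_measureP; split=> [|F mF tF mUF|A nA].
- by rewrite measure0.
- have mE A : measurable A -> (EFin \o (fun A => fine (mu A))) A = mu A.
    by move=> mA; rewrite /= fineK// fin_num_measure.
  rewrite mE//; under eq_fun do under eq_bigr do rewrite mE//.
  exact: measure_semi_sigma_additive.
- by rewrite prob_measure_out.
Qed.

Definition signed_of_prob (mu : prob_measure) : signed_measure T R :=
  SignedMeasure (signed_of_prob_subproof mu).

End prob_measure.

Section power_measure.
Context {d : measure_display} (T : measurableType d) (R : realType).

Definition tuple_of_pair (n : nat) (x : T * n.-tuple T) : n.+1.-tuple T :=
  [tuple of x.1 :: x.2].

Lemma measurable_tuple_of_pair (n : nat) :
  measurable_fun setT (@tuple_of_pair n).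
Proof. exact: measurable_cons. Qed.

(* [mu \x nu], transported from [T * n.-tuple T] to [n.+1.-tuple T]. *)
Definition power_step (n : nat) (mu : probability T R)
    (nu : probability (n.-tuple T) R) : set (n.+1.-tuple T) -> \bar R :=
  pushforward (mu \x nu)%E (@tuple_of_pair n).

Section power_step.
Variables (n : nat) (mu : probability T R) (nu : probability (n.-tuple T) R).

Let power_step0 : power_step mu nu set0 = 0%E.
Proof. by rewrite /power_step /pushforward preimage_set0 measure0. Qed.

Let power_step_ge0 A : (0 <= power_step mu nu A)%E.
Proof. by rewrite /power_step /pushforward measure_ge0. Qed.

Let power_step_sigma_additive : semi_sigma_additive (power_step mu nu).
Proof.
have mpre A : measurable A -> measurable (@tuple_of_pair n @^-1` A).
  by move=> mA; rewrite -[X in measurable X]setTI;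
    exact: measurable_tuple_of_pair.
move=> F mF tF mUF; rewrite /power_step /pushforward preimage_bigcup.
apply: measure_semi_sigma_additive.
- by move=> i; exact: mpre.
- apply/trivIsetP => /= i j _ _ ij; rewrite -preimage_setI.
  by move/trivIsetP : tF => /(_ _ _ _ _ ij) ->//; rewrite preimage_set0.
- by rewrite -preimage_bigcup; exact: mpre.
Qed.

HB.instance Definition _ := isMeasure.Build _ _ _ (power_step mu nu)
  power_step0 power_step_ge0 power_step_sigma_additive.

Let power_step_setT : power_step mu nu setT = 1%E.
Proof. by rewrite /power_step /pushforward preimage_setT probability_setT. Qed.

HB.instance Definition _ := Measure_isProbability.Build _ _ _
  (power_step mu nu) power_step_setT.

End power_step.

Fixpoint power_prob (mu : probability T R) (n : nat) :
    probability (n.-tuple T) R :=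
  if n is n'.+1 then power_step mu (power_prob mu n') else dirac [tuple].

Lemma power_prob_rectangle (mu : probability T R) (n : nat)
    (A : 'I_n -> set T) : (forall i, measurable (A i)) ->
  power_prob mu n [set t | forall i, A i (tnth t i)]
  = (\prod_(i < n) mu (A i))%E.
Proof.
elim: n A => [|n IHn] A mA.
  by rewrite big_ord0 /= diracE mem_set//= => -[].
rewrite big_ord_recl /= /power_step /pushforward.
pose B (i : 'I_n) := A (lift ord0 i).
have mB : measurable [set t : n.-tuple T | forall i, B i (tnth t i)].
  rewrite (_ : mkset _ =
    \bigcap_(i in [set: 'I_n]) (@tnth _ T ^~ i) @^-1` B i); last first.
    by apply/seteqP; split => t /= H i => [_|]; exact: H.
  apply: fin_bigcap_measurable => // i _.
  by rewrite -[X in measurable X]setTI; apply: measurable_tnth => //; exact: mA.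
rewrite (_ : _ @^-1` _ = A ord0 `*` [set t | forall i, B i (tnth t i)]).
  rewrite product_measure1E//; congr (_ * _)%E.
  by apply: (IHn B) => i; exact: mA.
apply/seteqP; split => [[x t]/= H|[x t]/= [H0 H] i].
  by split=> [|i]; [exact: (H ord0)|have := H (lift ord0 i); rewrite tnthS].
have [j ->|->] := unliftP ord0 i; last by [].
by rewrite tnthS; have := H j.
Qed.

End power_measure.

Section mixture.
Context {R : realType}.

Record weights (m : nat) := Weights {
  weight :> 'I_m -> R;
  weight_gt0 : forall i, 0 < weight i;
  weight_sum1 : \sum_(i < m) weight i = 1 }.

Section wsum.
Context {d : measure_display} {X : measurableType d}.
Variables (m : nat) (a : weights m) (nu : 'I_m -> probability X R).

Definition wsum : set X -> \bar R :=
  fun A => (\sum_(i < m) (a i)%:E * nu i A)%E.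

Let wsum0 : wsum set0 = 0%E.
Proof. by rewrite /wsum big1// => i _; rewrite measure0 mule0. Qed.

Let wsum_ge0 A : (0 <= wsum A)%E.
Proof.
by apply: sume_ge0 => i _; rewrite mule_ge0// lee_fin ltW// weight_gt0.
Qed.

Let wsum_sigma_additive : semi_sigma_additive wsum.
Proof.
move=> F mF tF mUF; rewrite /wsum.
under eq_fun do rewrite exchange_big/=.
apply: cvg_nnesum => [i _|i _].
  apply: nearW => n; apply: sume_ge0 => k _.
  by rewrite mule_ge0// lee_fin ltW// weight_gt0.
under eq_fun do rewrite -ge0_sume_distrr//.
by apply: cvgeZl => //; exact: measure_semi_sigma_additive.
Qed.

HB.instance Definition _ := isMeasure.Build _ _ _ wsum
  wsum0 wsum_ge0 wsum_sigma_additive.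

Let wsum_setT : wsum setT = 1%E.
Proof.
rewrite /wsum; under eq_bigr do rewrite probability_setT mule1.
by rewrite sumEFin weight_sum1.
Qed.

HB.instance Definition _ := Measure_isProbability.Build _ _ _ wsum wsum_setT.

End wsum.

Context {d : measure_display} {T : measurableType d}.

Record mixture (m : nat) := Mixture {
  mixture_weights : weights m;
  component : 'I_m -> prob_measure T R;
  component_inj : injective component }.

Definition mixture_measure (m : nat) (P : mixture m) :
    probability (prob_measure T R) R :=
  wsum (mixture_weights P) (fun i => dirac (component P i)).

Definition V (n m : nat) (P : mixture m) : probability (n.-tuple T) R :=
  wsum (mixture_weights P) (fun i => power_prob (component P i) n).

(* All subsets of [prob_measure T R] are measurable, so that [<>] compares
   measures; [V n P'] and [V n P] have to be compared on measurable sets. *)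
Definition identifiable (n m : nat) (P : mixture m) :=
  ~ exists (m' : nat) (P' : mixture m'),
    [/\ (m' <= m)%N,
        mixture_measure P' <> mixture_measure P :> (set _ -> \bar R) &
        forall A, measurable A -> V n P' A = V n P A].

End mixture.

Arguments mixture R {d} T m.

(* Main.v *)
(** For a mixture [P'] with [V_n P' = V_n P], the signed combination
    [\sum_i a_i mu_i^n - \sum_j b_j nu_j^n] vanishes. Split it into minimal
    vanishing subsums. The tensors of a minimal vanishing subsum do not split as
    a direct sum, and rank-one tensors that do not split have rank at least
    [\sum_modes (d - 1) + 1], where [d] is the dimension of the span of a mode
    (the splitting theorem of Lovitz and Petrov, which generalizes Kruskal's).
    So a minimal subsum with [s] of the [mu]'s and [t] of the [nu]'s has
    [s + t >= n (min (s, k) - 1) + 2], which together with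
    [2 m - 1 <= (k - 1) n] forces [s < t] or [s = t = 1]. As [P'] has at most
    [m] components, only the pairs [s = t = 1] occur, and each of them matches a
    component and its weight in [P] with those of [P']. *)
Require Import Defs.
From mathcomp Require Import all_boot all_order all_algebra.
From mathcomp Require Import all_classical all_reals all_analysis.
From mathcomp Require Import zify.

Set Implicit Arguments.
Unset Strict Implicit.
Unset Printing Implicit Defensive.
Import Order.TTheory GRing.Theory Num.Theory.

Local Open Scope ring_scope.

(** * Masked matrices and row-wise tensor products *)

Section KhatriRao.
Variable F : fieldType.

Definition mask_row N (S : {set 'I_N}) (e : 'rV[F]_N) : 'rV[F]_N :=
  \row_a (e 0 a *+ (a \in S)).

Definition supp N (e : 'rV[F]_N) : {set 'I_N} := finset (fun a => e 0 a != 0).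

(** Rows outside [S] are zeroed, not deleted, so that the size of the matrix does not depend on
    [S]. *)
Definition restrict_rows N p (S : {set 'I_N}) (X : 'M[F]_(N, p)) :=
  diag_mx (mask_row S (const_mx 1)) *m X.

(** Row [a] is the tensor product of row [a] of [X] and row [a] of [Y], flattened by [mxvec]. *)
Definition khatri_rao N p q (X : 'M[F]_(N, p)) (Y : 'M[F]_(N, q)) :=
  \matrix_a mxvec ((row a X)^T *m row a Y).

(** The width is [p ^ n], in the form that unfolds along the recursion. *)
Fixpoint khatri_rao_pow N p (X : 'M[F]_(N, p)) n : 'M[F]_(N, iter n (muln p) 1) :=
  if n is n'.+1 then khatri_rao X (khatri_rao_pow X n') else const_mx 1.

(* No nonempty proper set of rows has a span that is in direct sum with the span
   of the remaining rows. *)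
Definition nonsplit N p (Z : 'M[F]_(N, p)) :=
  forall S : {set 'I_N}, S != finset.set0 -> S != finset.setT ->
  exists2 e : 'rV[F]_N, e *m Z = 0 & mask_row S e *m Z != 0.

Lemma mask_rowE N (S : {set 'I_N}) e a : mask_row S e 0 a = e 0 a *+ (a \in S).
Proof. by rewrite mxE. Qed.

Lemma mask_rowB N (S : {set 'I_N}) t e f :
  mask_row S (e - t *: f) = mask_row S e - t *: mask_row S f.
Proof. by apply/rowP=> a; rewrite !mxE mulrnBl mulrnAr. Qed.

Lemma mask_row_diag N (S : {set 'I_N}) e :
  mask_row S e = e *m diag_mx (mask_row S (const_mx 1)).
Proof. by apply/rowP=> a; rewrite mul_mx_diag !mxE mulrnAr mulr1. Qed.

Lemma diag_mask_row N (S : {set 'I_N}) e :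
  diag_mx (mask_row S e) =
    diag_mx e *m diag_mx (mask_row S (const_mx 1)).
Proof.
by rewrite mulmx_diag; congr diag_mx; apply/rowP=> a; rewrite !mxE mulrnAr mulr1.
Qed.

(** Linear relations between tensors become matrix equations, to which rank inequalities apply. *)
Lemma mul_rV_khatri_rao N p q (X : 'M[F]_(N, p)) (Y : 'M[F]_(N, q)) (e : 'rV[F]_N) :
  e *m khatri_rao X Y = mxvec (X^T *m diag_mx e *m Y).
Proof.
apply/rowP=> k; case/mxvec_indexP: k => i j; rewrite mxvecE mul_mx_diag !mxE.
by apply: eq_bigr => a _; rewrite !mxE mxvecE !mxE big_ord1 !mxE mulrCA mulrA.
Qed.

Lemma rank_diag_leq N (S : {set 'I_N}) (e : 'rV[F]_N) :
  (forall a, a \notin S -> e 0 a = 0) -> (\rank (diag_mx e) <= #|S|)%N.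
Proof.
move=> eS; rewrite diag_mx_sum_delta (bigID (mem S)) /= [X in _ + X]big1 ?addr0.
  rewrite -sum1_card; elim/big_rec2: _ => [|a r M _ le]; first by rewrite mxrank0.
  apply: leq_trans (mxrank_add _ _) _; apply: leq_add => //.
  by rewrite (leq_trans (mxrank_scale _ _))// mxrank_delta.
by move=> a /eS ->; rewrite scale0r.
Qed.

(** A diagonal matrix supported outside [S], hence of rank at most [#|~: S|], completes [diag_mx e]
    to an invertible one. *)
Lemma rank_diag_geq N (S : {set 'I_N}) (e : 'rV[F]_N) :
  (forall a, a \in S -> e 0 a != 0) -> (#|S| <= \rank (diag_mx e))%N.
Proof.
move=> eS; have /= := mxrank_add (diag_mx e) (diag_mx (mask_row (~: S) (const_mx 1 - e))).
pose f := \row_a (if a \in S then e 0 a else 1).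
rewrite -linearD /= (_ : e + _ = f); last first.
  apply/rowP=> a; rewrite !mxE inE; case: (a \in S) => /=; first by rewrite addr0.
  by rewrite addrC subrK.
have -> : \rank (diag_mx f) = N.
  apply/mxrank_unit; rewrite unitmxE det_diag unitfE; apply/prodf_neq0=> a _.
  by rewrite mxE; case: ifP => [/eS//|_]; rewrite oner_eq0.
move=> le; rewrite -(leq_add2r #|~: S|) cardsC card_ord (leq_trans le)//.
by rewrite leq_add2l rank_diag_leq// => a /negPf aS; rewrite mxE aS.
Qed.

(** Multiplication by [cokermx B] is the quotient by the row space of [B]. *)
Lemma rank_adds_coker m1 m2 n (A : 'M[F]_(m1, n)) (B : 'M[F]_(m2, n)) :
  \rank (A + B)%MS = (\rank B + \rank (A *m cokermx B))%N.
Proof.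
apply/eqP; rewrite -(eqn_add2r (\rank (A :&: B)%MS)) mxrank_sum_cap -addnA addnC.
have -> : \rank (A :&: B)%MS = \rank (A :&: kermx (cokermx B))%MS.
  have H : (kermx (cokermx B) :=: B)%MS.
    apply/eqmxP; rewrite /eqmx submxE mulmx_ker eqxx /=.
    by rewrite sub_kermx mulmx_coker.
  by apply: eqmx_rank; apply/eqmxP; apply: cap_eqmx => //; apply: eqmx_sym.
by rewrite mxrank_mul_ker addnC.
Qed.

Lemma restrict_rowsT N p (X : 'M[F]_(N, p)) : restrict_rows finset.setT X = X.
Proof.
rewrite /restrict_rows (_ : diag_mx _ = 1%:M) ?mul1mx//.
by apply/matrixP=> i j; rewrite !mxE inE.
Qed.

Lemma restrict_sub N p (S A : {set 'I_N}) (X : 'M[F]_(N, p)) :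
  S \subset A -> (restrict_rows S X <= restrict_rows A X)%MS.
Proof.
move=> /fintype.subsetP SA; apply/submxP; exists (diag_mx (mask_row S (const_mx 1))).
rewrite /restrict_rows mulmxA mulmx_diag; congr (diag_mx _ *m _).
apply/rowP=> a; rewrite !mxE; case: (boolP (a \in S)) => [/SA ->|_].
  by rewrite mulr1.
by rewrite mul0r.
Qed.

Lemma diag_sub_restrict N p (S : {set 'I_N}) (e : 'rV[F]_N) (X : 'M[F]_(N, p)) :
  (forall a, a \notin S -> e 0 a = 0) -> (diag_mx e *m X <= restrict_rows S X)%MS.
Proof.
move=> eS; apply/submxP; exists (diag_mx e).
rewrite /restrict_rows mulmxA mulmx_diag; congr (diag_mx _ *m _).
by apply/rowP=> a; rewrite !mxE; case: (boolP (a \in S)) => [_|/eS ->];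
  rewrite ?mulr1 ?mul0r.
Qed.

Lemma row_mul_diag N p (e : 'rV[F]_N) (X : 'M[F]_(N, p)) a :
  row a (diag_mx e *m X) = e 0 a *: row a X.
Proof. by apply/rowP=> j; rewrite mul_diag_mx !mxE. Qed.

Lemma restrict_sub_adds N p (S A : {set 'I_N}) (e : 'rV[F]_N) (X : 'M[F]_(N, p)) :
  (forall a, a \in A -> e 0 a != 0) ->
  (restrict_rows (S :|: A) X <= diag_mx e *m X + restrict_rows S X)%MS.
Proof.
move=> eA; apply/row_subP=> a; rewrite row_mul_diag mask_rowE inE.
case: (boolP (a \in S)) => /= aS.
  rewrite mxE mulr1n scale1r.
  have -> : row a X = row a (restrict_rows S X).
    by rewrite /restrict_rows row_mul_diag mask_rowE aS mxE mulr1n scale1r.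
  by rewrite (submx_trans (row_sub _ _))// addsmxSr.
case: (boolP (a \in A)) => aA; last by rewrite mulr0n scale0r sub0mx.
rewrite mxE mulr1n scale1r.
have -> : row a X = (e 0 a)^-1 *: row a (diag_mx e *m X).
  by rewrite row_mul_diag scalerA mulVf ?eA// scale1r.
by rewrite scalemx_sub// (submx_trans (row_sub _ _))// addsmxSl.
Qed.

(** * Rank of tensor products that do not split *)

Lemma minimal_relation N p (Z : 'M[F]_(N, p)) (S : {set 'I_N}) (e0 : 'rV[F]_N) :
  e0 *m Z = 0 -> mask_row S e0 *m Z != 0 ->
  exists e : 'rV[F]_N, [/\ e *m Z = 0, mask_row S e *m Z != 0 &
    forall f : 'rV[F]_N, f *m Z = 0 -> mask_row S f *m Z != 0 ->
     (#|supp e :\: S| <= #|supp f :\: S|)%N].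
Proof.
move=> e0Z e0S.
pose P k := `[< exists e : 'rV[F]_N, [/\ e *m Z = 0, mask_row S e *m Z != 0 &
  #|supp e :\: S| = k] >].
have exP : exists k, P k.
  by exists #|supp e0 :\: S|; apply/asboolP; exists e0.
case: (ex_minnP exP) => k /asboolP[e [eZ eS <-]] kmin.
exists e; split=> // f fZ fS; apply: kmin.
by apply/asboolP; exists f.
Qed.

(* The rows of [S' \ S] carry a minimal relation [e] between [S] and its
   complement. Minimality makes them independent modulo the span of [S], up to
   one relation. In exchange the common value [W] of the two sides of [e] is a
   nonzero matrix whose row space lies in the span of both parts of [Y]. *)
Lemma khatri_rao_rank_step N p q (X : 'M[F]_(N, p)) (Y : 'M[F]_(N, q))
    (S : {set 'I_N}) :
  nonsplit (khatri_rao X Y) -> S != finset.set0 -> S != finset.setT ->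
  (\rank (restrict_rows S X) + \rank (restrict_rows S Y)
    <= (\rank (restrict_rows S (khatri_rao X Y))).+1)%N ->
  exists2 S' : {set 'I_N}, S \proper S' &
  (\rank (restrict_rows S' X) + \rank (restrict_rows S' Y)
    <= (\rank (restrict_rows S' (khatri_rao X Y))).+1)%N.
Proof.
set Z := khatri_rao X Y => cZ S0 ST rS.
have [e0 e0Z e0S] := cZ S S0 ST.
have [e [eZ eS emin]] := minimal_relation e0Z e0S.
pose A := supp e :\: S.
have inA a : (a \in A) = (a \notin S) && (e 0 a != 0) by rewrite !inE.
have A_out a : a \notin A -> a \notin S -> e 0 a = 0.
  by rewrite inA => + aS; rewrite aS negbK => /eqP.
(* By minimality of [e], a relation whose support outside [S] is a proper part of [A] splits: its
   [S]-part is itself a relation. *)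
have small (f : 'rV[F]_N) a0 : a0 \in A -> f *m Z = 0 -> f 0 a0 = 0 ->
    (forall a, a \notin S -> a \notin A -> f 0 a = 0) -> mask_row S f *m Z = 0.
  move=> a0A fZ f0 fA; apply/eqP/contraT => /(emin _ fZ).
  rewrite leqNgt => /negP[]; apply: proper_card; apply/properP; split.
    apply/fintype.subsetP => a; rewrite !inE => /andP[aS fa]; rewrite aS /=.
    by apply: contraNneq fa => ea; rewrite fA// inA aS ea eqxx.
  by exists a0 => //; rewrite !inE f0 eqxx andbF.
have eE : e = mask_row S e + mask_row A e.
  apply/rowP=> a; rewrite !mxE; case: (boolP (a \in S)) => aS.
    by rewrite inA aS addr0.
  by case: (boolP (a \in A)) => aA; rewrite add0r// A_out.
have [a0 a0A] : exists a0, a0 \in A.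
  apply/finset.set0Pn; apply: contraNneq eS => A0.
  rewrite -eZ [in X in _ == X]eE; apply/eqP; congr (_ *m _).
  rewrite (_ : mask_row A e = 0) ?addr0//.
  by apply/rowP=> a; rewrite !mxE A0 inE.
pose DA := diag_mx (mask_row A e).
have mA a : a \in A -> mask_row A e 0 a != 0.
  by move=> aA; rewrite mxE aA; move: aA; rewrite inA => /andP[].
have mA0 a : a \notin A -> mask_row A e 0 a = 0 by move=> /negPf; rewrite mxE => ->.
exists (S :|: A).
  apply/properP; split; first exact: finset.subsetUl.
  by exists a0; [rewrite inE a0A orbT|move: a0A; rewrite inA => /andP[]].
(* Modulo the rows in [S], the only relations between the rows of [Z] in [A] are multiples of
   [mask_row A e], so the rank grows by at least [#|A| - 1]. *)
have rkZ : (\rank (restrict_rows S Z) + #|A| <= (\rank (restrict_rows (S :|: A) Z)).+1)%N.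
  have : (\rank (DA *m Z + restrict_rows S Z)%MS <= \rank (restrict_rows (S :|: A) Z))%N.
    apply: mxrankS; rewrite addsmx_sub restrict_sub ?finset.subsetUl// andbT.
    by apply: diag_sub_restrict => a; rewrite inE negb_or => /andP[_ /mA0].
  rewrite rank_adds_coker -mulmxA => le; rewrite -addn1.
  apply: leq_trans (leq_add le (leqnn 1)); rewrite -addnA leq_add2l.
  apply: leq_trans (rank_diag_geq mA) _.
  rewrite -(mxrank_mul_ker DA (Z *m cokermx (restrict_rows S Z))) leq_add2l.
  apply: leq_trans (mxrankS _) (rank_leq_row (mask_row A e)).
  apply/rV_subP => v; rewrite sub_capmx sub_kermx mulmxA -submxE.
  move=> /andP[/submxP[w vE] /submxP[y]].
  rewrite /restrict_rows mulmxA -mask_row_diag => vZ.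
  have vA a : a \notin A -> v 0 a = 0.
    by move=> aA; rewrite vE mul_mx_diag mxE mA0// mulr0.
  pose f : 'rV[F]_N := v - mask_row S y.
  have fZ : f *m Z = 0 by rewrite mulmxBl vZ subrr.
  have fE a : a \notin S -> f 0 a = v 0 a.
    by move=> /negPf aS; rewrite !mxE aS subr0.
  have e_neq0 : e 0 a0 != 0 by move: a0A; rewrite inA => /andP[].
  have AS a : a \in A -> a \notin S by rewrite inA => /andP[].
  pose t := v 0 a0 / e 0 a0.
  suff -> : v = t *: mask_row A e by rewrite scalemx_sub.
  apply/rowP=> a1; apply/eqP; apply: contraNT eS => va1.
  have a1A : a1 \in A.
    by apply: contraNT va1 => a1A; rewrite vA// mxE mA0// mulr0.
  (* Eliminating [a0], then [a1], leaves a relation contradicting minimality. *)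
  pose g : 'rV[F]_N := f - t *: e.
  have gZ : g *m Z = 0 by rewrite mulmxBl fZ -scalemxAl eZ scaler0 subrr.
  have subE (u1 u2 : 'rV[F]_N) c a : (u1 - c *: u2) 0 a = u1 0 a - c * u2 0 a.
    by rewrite !mxE.
  have gE a : g 0 a = f 0 a - t * e 0 a by rewrite subE.
  have g1 : g 0 a1 != 0.
    by rewrite gE fE ?AS// subr_eq0; move: va1; rewrite mxE mask_rowE a1A mulr1n.
  have gS : mask_row S g *m Z = 0.
    apply: (small g a0) => //; first by rewrite gE fE ?AS// divfK// subrr.
    by move=> a aS aA; rewrite gE fE// vA// A_out// mulr0 subrr.
  have := small (e - (e 0 a1 / g 0 a1) *: g) a1 a1A.
  rewrite mask_rowB !mulmxBl -!scalemxAl eZ gZ gS !scaler0 !subr0.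
  move=> H; apply/eqP/H => //; first by rewrite subE divfK// subrr.
  move=> a aS aA; rewrite subE [g 0 a]gE fE//.
  by rewrite vA// A_out// mulr0 subrr mulr0 subrr.
pose W := X^T *m DA *m Y.
have WE : W = - (X^T *m diag_mx (mask_row S e) *m Y).
  apply/eqP; rewrite -addr_eq0 -mulmxDl -mulmxDr -linearD /= addrC -eE.
  by rewrite -mxvec_eq0 -mul_rV_khatri_rao eZ.
have W0 : W != 0.
  by rewrite WE oppr_eq0 -mxvec_eq0 -mul_rV_khatri_rao.
have Wcap : (W <= DA *m Y :&: restrict_rows S Y)%MS.
  rewrite sub_capmx {1}/W -mulmxA submxMl WE diag_mask_row.
  by rewrite -!mulmxA !mulmxA -mulmxA -mulNmx submxMl.
(* [Q] kills the rows of [X] in [S], from which [W] can also be computed. So the product below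
   vanishes, and the Frobenius inequality bounds the sum of the ranks of [DA *m X *m Q] and
   [DA *m Y] by [#|A|]. *)
pose Q := cokermx (restrict_rows S X).
have QW : (X *m Q)^T *m DA *m Y = 0.
  rewrite trmx_mul -2!mulmxA [X^T *m _]mulmxA -/W WE mulmxN mulmxA mulmxA.
  rewrite (_ : Q^T *m X^T *m _ = 0) ?mul0mx ?oppr0//.
  apply: trmx_inj; rewrite !trmx_mul !trmxK tr_diag_mx diag_mask_row.
  by rewrite trmx0 -!mulmxA [diag_mx _ *m (X *m Q)]mulmxA mulmx_coker mulmx0.
have := mxrank_Frobenius (X *m Q)^T DA Y.
rewrite QW mxrank0 addn0 -[\rank (_^T *m _)]mxrank_tr trmx_mul trmxK tr_diag_mx mulmxA.
move=> /leq_trans/(_ (rank_diag_leq mA0)) frob.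
(* The nonzero [W] in the intersection makes up for the one dimension lost in [rkZ]. *)
have capY : (0 < \rank (DA *m Y :&: restrict_rows S Y)%MS)%N.
  by rewrite (leq_trans _ (mxrankS Wcap))// lt0n mxrank_eq0.
have leY := mxrankS (restrict_sub_adds S Y mA).
have := mxrankS (restrict_sub_adds S X mA).
rewrite rank_adds_coker -/Q => leX.
move: (mxrank_sum_cap (DA *m Y) (restrict_rows S Y)).
move: frob capY leX leY rkZ rS; clear; rewrite -/DA.
have arith (n1 n2 n3 n4 n5 n6 n7 n8 n9 n10 n11 : nat) :
  (n1 + n2 <= n3 -> 0 < n4 -> n5 <= n6 + n1 -> n7 <= n8 -> n9 + n3 <= n10.+1 ->
   n6 + n11 <= n9.+1 -> n8 + n4 = n2 + n11 -> n5 + n7 <= n10.+1)%N by lia.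
exact: arith.
Qed.

(** A single row is enlarged by [khatri_rao_rank_step] until all rows are reached; [r] bounds the
    number of missing rows. *)
Lemma khatri_rao_rank N p q (X : 'M[F]_(N, p)) (Y : 'M[F]_(N, q)) :
  (0 < N)%N -> nonsplit (khatri_rao X Y) ->
  (\rank X + \rank Y <= (\rank (khatri_rao X Y)).+1)%N.
Proof.
case: N X Y => // N X Y _ cXY.
have grow r (S : {set 'I_N.+1}) : (#|~: S| <= r)%N -> S != finset.set0 ->
    (\rank (restrict_rows S X) + \rank (restrict_rows S Y)
      <= (\rank (restrict_rows S (khatri_rao X Y))).+1)%N ->
    (\rank X + \rank Y <= (\rank (khatri_rao X Y)).+1)%N.
  elim: r S => [|r IHr] S Sr S0 rS; have [ST|ST] := eqVneq S finset.setT.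
  - by move: rS; rewrite ST !restrict_rowsT.
  - by move: Sr; rewrite leqn0 cards_eq0 -(inj_eq (@finset.setC_inj _))
      finset.setCK finset.setC0 (negPf ST).
  - by move: rS; rewrite ST !restrict_rowsT.
  - have [S' SS' rS'] := khatri_rao_rank_step cXY S0 ST rS.
    apply: (IHr S') => //.
      have := proper_card SS'; have := cardsC S; have := cardsC S'.
      by move: Sr; clear; lia.
    by apply: contraNneq S0 => S'0; rewrite -finset.subset0 -S'0 proper_sub.
apply: (grow _ (finset.set1 ord0) (leqnn _)).
  by apply/finset.set0Pn; exists ord0; rewrite inE.
have rank1 u (M : 'M[F]_(N.+1, u)) :
    (restrict_rows (finset.set1 ord0) M == row ord0 M)%MS.
  apply/andP; split; last first.
    have -> : row ord0 M = row ord0 (restrict_rows (finset.set1 ord0) M).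
      by rewrite /restrict_rows row_mul_diag mask_rowE inE eqxx mxE scale1r.
    exact: row_sub.
  apply/row_subP=> i; rewrite /restrict_rows row_mul_diag mask_rowE inE.
  have [->|_] := eqVneq i ord0; first by rewrite scalemx_sub.
  by rewrite mulr0n scale0r sub0mx.
(* For one row the ranks are 0 or 1, and the point is that the tensor product of two nonzero rows is
   nonzero. *)
rewrite !(eqmx_rank (rank1 _ _)) rowK !rank_rV mxvec_eq0.
have [->|X0] := eqVneq (row ord0 X) 0; first by rewrite add0n; case: (_ != 0).
have [->|Y0] := eqVneq (row ord0 Y) 0; first by rewrite addn0.
case: (_ =P 0) => // XY; case/eqP: Y0; apply/rowP=> j; rewrite [RHS]mxE.
have /rV0Pn[i Xi] := X0.
have /matrixP/(_ i j) := XY; rewrite mxE big_ord1 !mxE => /eqP.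
rewrite mulf_eq0 => /orP[|/eqP //].
by move: Xi; rewrite mxE => /negPf ->.
Qed.

(** A nonzero entry in row [i] of the masked matrix equation selects column [i] of [X]; weighting
    [e] by that column gives the relation for [Y]. *)
Lemma nonsplit_khatri_raoR N p q (X : 'M[F]_(N, p)) (Y : 'M[F]_(N, q)) :
  nonsplit (khatri_rao X Y) -> nonsplit Y.
Proof.
move=> cXY S S0 ST; have [e] := cXY S S0 ST.
rewrite !mul_rV_khatri_rao => /eqP; rewrite !mxvec_eq0 => /eqP eXY.
case/matrix0Pn=> i [j eij].
have entry (f : 'rV[F]_N) k : (X^T *m diag_mx f *m Y) i k =
    ((\row_a (X a i * f 0 a)) *m Y) 0 k.
  by rewrite mul_mx_diag !mxE; apply: eq_bigr => a _; rewrite !mxE.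
exists (\row_a (X a i * e 0 a)).
  by apply/rowP=> k; rewrite -entry eXY !mxE.
apply/rV0Pn; exists j; rewrite (_ : mask_row S _ = \row_a (X a i * mask_row S e 0 a)).
  by rewrite -entry.
by apply/rowP=> a; rewrite !mxE mulrnAr.
Qed.

(** Each factor contributes [\rank X - 1] by [khatri_rao_rank]; the shorter powers stay nonsplit. *)
Lemma khatri_rao_pow_rank N p (X : 'M[F]_(N, p)) n :
  (0 < N)%N -> (0 < \rank X)%N -> nonsplit (khatri_rao_pow X n) ->
  (n * (\rank X).-1 < \rank (khatri_rao_pow X n))%N.
Proof.
move=> N0 X0; elim: n => [|n IHn] cX /=.
  rewrite mul0n lt0n mxrank_eq0; apply/matrix0Pn.
  by exists (Ordinal N0), ord0; rewrite mxE oner_eq0.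
have := khatri_rao_rank N0 cX; have := IHn (nonsplit_khatri_raoR cX).
rewrite mulSn; case: (\rank X) X0 => // r _ ltr.
by rewrite addSn ltnS; apply: leq_trans; rewrite ltn_add2l.
Qed.

(** * From families of functions to finite matrices *)

(* The coordinates [s] are those of a matrix of maximal rank. *)
Lemma finite_coordinates N (I : Type) (x : 'I_N -> I -> F) :
  exists D (s : 'I_D -> I), forall c : 'rV[F]_N,
    c *m (\matrix_(a, j) x a (s j)) = 0 -> forall t, \sum_a c 0 a * x a t = 0.
Proof.
pose M D (s : 'I_D -> I) : 'M[F]_(N, D) := \matrix_(a, j) x a (s j).
pose P (r : nat) := `[< exists D (s : 'I_D -> I), \rank (M D s) = r >].
have P0 : exists r, P r.
  have s0 : 'I_0 -> I by case.
  by exists (\rank (M 0%N s0)); apply/asboolP; eexists _, _.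
have Pub r : P r -> (r <= N)%N by move=> /asboolP[D [s <-]]; exact: rank_leq_row.
case: (ex_maxnP P0 Pub) => r /asboolP[D [s rs]] rmax.
exists D, s => c cM t; rewrite -/(M D s) in cM.
(* Appending the coordinate [t] cannot raise the maximal rank, so the two nested left kernels have
   equal dimension and coincide. *)
pose s' (i : 'I_(D + 1)) := if fintype.split i is inl j then s j else t.
pose Mt := \col_a x a t.
have Ms' : M _ s' = row_mx (M D s) Mt.
  apply/matrixP=> a j; rewrite !mxE /s'.
  by case: (fintype.split j) => k; rewrite !mxE.
have le : (\rank (M _ s') <= \rank (M D s))%N.
  by rewrite rs rmax//; apply/asboolP; eexists _, _.
have sub : (kermx (M _ s') <= kermx (M D s))%MS.
  rewrite sub_kermx; have := mulmx_ker (M _ s'); rewrite {2}Ms' mul_mx_row => /eqP.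
  by rewrite row_mx_eq0 => /andP[].
have := mxrank_leqif_sup sub; rewrite !mxrank_ker => -[_].
have -> : (N - \rank (M _ s') == N - \rank (M D s))%N.
  rewrite eqn_leq leq_sub2l//=; last first.
    rewrite Ms' -[leqLHS]mxrank_tr -[leqRHS]mxrank_tr tr_row_mx.
    by apply: mxrankS; rewrite -addsmxE addsmxSl.
  by rewrite leq_sub2l.
move=> /esym sub'; have cker : (c <= kermx (M D s))%MS by rewrite sub_kermx cM.
have := submx_trans cker sub'; rewrite sub_kermx Ms' mul_mx_row row_mx_eq0.
move=> /andP[_ /eqP/rowP/(_ ord0)]; rewrite !mxE => c0; rewrite -[RHS]c0.
by apply: eq_bigr => a _; rewrite !mxE.
Qed.

Lemma khatri_rao_pow_eq0 N (I : Type) (x : 'I_N -> I -> F) D (s : 'I_D -> I) n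
    (c : 'rV[F]_N) :
  (forall c : 'rV[F]_N,
    c *m (\matrix_(a, j) x a (s j)) = 0 -> forall t, \sum_a c 0 a * x a t = 0) ->
  c *m khatri_rao_pow (\matrix_(a, j) x a (s j)) n = 0 <->
  forall A : seq I, size A = n -> \sum_a c 0 a * \prod_(t <- A) x a t = 0.
Proof.
move=> xs; elim: n c => [|n IHn] c /=.
  split=> [/rowP/(_ ord0) c0 A /size0nil->|c0].
    move: c0; rewrite !mxE => c0; rewrite -[RHS]c0.
    by apply: eq_bigr => a _; rewrite mxE big_nil.
  apply/rowP=> j; rewrite !mxE -[RHS](c0 [::] erefl).
  by apply: eq_bigr => a _; rewrite mxE big_nil.
rewrite mul_rV_khatri_rao.
set X := \matrix_(a, j) x a (s j).
have entry j k : (X^T *m diag_mx c *m khatri_rao_pow X n) j k =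
    ((\row_a (c 0 a * x a (s j))) *m khatri_rao_pow X n) 0 k.
  rewrite mul_mx_diag !mxE; apply: eq_bigr => a _.
  by rewrite !mxE [x _ _ * _]mulrC.
split=> [/eqP|c0].
  rewrite mxvec_eq0 => /eqP c0 [//|t A] [An].
  under eq_bigr do rewrite big_cons mulrCA mulrC -mulrA.
  have := xs (\row_a (c 0 a * \prod_(t <- A) x a t)) _ t.
  have H : \row_a (c 0 a * \prod_(t <- A) x a t) *m X = 0.
    apply/rowP=> j; rewrite !mxE.
    have /IHn/(_ A An) : (\row_a (c 0 a * x a (s j))) *m khatri_rao_pow X n = 0.
      by apply/rowP=> k; rewrite -entry c0 !mxE.
    by move=> c1; rewrite -[RHS]c1; apply: eq_bigr => a _; rewrite !mxE mulrAC.
  move=> /(_ H) c1; rewrite -[RHS]c1; apply: eq_bigr => a _.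
  by rewrite !mxE mulrA.
apply/eqP; rewrite mxvec_eq0; apply/eqP/matrixP=> j k; rewrite entry.
suff -> : (\row_a (c 0 a * x a (s j))) *m khatri_rao_pow X n = 0 by rewrite !mxE.
apply/IHn => A An; rewrite -[RHS](c0 (s j :: A)) ?/= ?An//.
by apply: eq_bigr => a _; rewrite !mxE big_cons mulrA.
Qed.

End KhatriRao.

(** * Minimal vanishing sums of tensor powers *)

Section Vanishing.
Variables (F : fieldType) (E : finType) (I : Type).
Variables (x : E -> I -> F) (c : E -> F) (n : nat).

(** This says that the [n]-th tensor powers of the [x a], weighted by [c], sum to zero over [S]; it
    is tested pointwise, as [I] may be infinite. *)
Definition vanishing (S : {set E}) :=
  forall A : seq I, size A = n -> \sum_(a in S) c a * \prod_(t <- A) x a t = 0.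

Definition independent_on (K : {set E}) :=
  forall f : E -> F, (forall t, \sum_(a in K) f a * x a t = 0) ->
  forall a, a \in K -> f a = 0.

(** Minimality makes the tensor powers nonsplit, so their rank exceeds [n * #|K|.-1]; the relation
    [c] keeps it below [#|S|]. The two strict inequalities give the [+ 2]. *)
Lemma minimal_vanishing_card (S K : {set E}) :
  vanishing S ->
  (forall S' : {set E}, S' \proper S -> S' != finset.set0 -> ~ vanishing S') ->
  (forall a, c a != 0) -> K \subset S -> (0 < #|K|)%N -> independent_on K ->
  (n * #|K|.-1 + 2 <= #|S|)%N.
Proof.
move=> vS minS c0 KS K0 indK.
have S0 : (0 < #|S|)%N := leq_trans K0 (subset_leq_card KS).
pose y (i : 'I_#|S|) := x (enum_val i).
have [D [s ys]] := finite_coordinates y.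
pose X : 'M[F]_(#|S|, D) := \matrix_(i, j) y i (s j).
pose e : 'rV[F]_#|S| := \row_i c (enum_val i).
have e_pow : e *m khatri_rao_pow X n = 0.
  apply/(khatri_rao_pow_eq0 _ _ ys) => A An.
  rewrite -[RHS](vS A An) [RHS]big_enum_val; apply: eq_bigr => i _.
  by rewrite mxE.
have rkX : (#|K| <= \rank X)%N.
  pose K' : {set 'I_#|S|} := finset (fun i => enum_val i \in K).
  have K'E : finset.imset enum_val (mem K') = K.
    apply/setP => a; apply/imsetP/idP => [[i]|aK]; first by rewrite inE => iK ->.
    have aS := fintype.subsetP KS _ aK.
    by exists (enum_rank_in aS a); rewrite ?inE enum_rankK_in.
  have cK' : #|K'| = #|K| by rewrite -K'E card_imset//; exact: enum_val_inj.
  pose DK := diag_mx (mask_row K' (const_mx 1 : 'rV[F]_#|S|)).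
  have := mxrank_mul_ker DK X.
  have -> : (DK :&: kermx X)%MS = 0.
    apply/eqP; rewrite -submx0; apply/rV_subP => v.
    rewrite sub_capmx sub_kermx submx0 => /andP[/submxP[w vE] /eqP vX].
    have v_out i : i \notin K' -> v 0 i = 0.
      by move=> /negPf iK; rewrite vE mul_mx_diag !mxE iK mulr0.
    have [a0 a0K] := card_gt0P K0.
    have a0S := fintype.subsetP KS _ a0K.
    have fK : forall a, a \in K -> v 0 (enum_rank_in a0S a) = 0.
      apply: indK => t; rewrite -[RHS](ys v vX t).
      rewrite -{1}K'E big_imset//=; last first.
        by move=> i j _ _; exact: enum_val_inj.
      rewrite big_mkcond; apply: eq_bigr => i _; rewrite enum_valK_in.
      by case: ifPn => // /v_out ->; rewrite mul0r.
    apply/eqP/rowP=> i; rewrite [RHS]mxE; have [iK|/v_out//] := boolP (i \in K').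
    by rewrite -(enum_valK_in a0S i) fK//; move: iK; rewrite inE.
  rewrite mxrank0 addn0 -cK' => rk.
  apply: leq_trans (mxrankM_maxr DK X); rewrite rk.
  by apply: rank_diag_geq => i iK; rewrite mask_rowE iK mxE oner_neq0.
have cX : nonsplit (khatri_rao_pow X n).
  (* The same relation [e] works for every [T]: if its part on [T] vanished, it would be a smaller
     vanishing subsum. *)
  move=> T T0 TT; exists e => //; apply/eqP.
  move=> /(khatri_rao_pow_eq0 _ _ ys) vT.
  have inj : {in T &, injective (@enum_val _ (mem S))}.
    by move=> i j _ _; exact: enum_val_inj.
  apply: (minS (finset.imset enum_val (mem T))) => [||A An].
  - rewrite properEcard; apply/andP; split.
      by apply/fintype.subsetP => _ /imsetP[i _ ->]; exact: enum_valP.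
    rewrite card_in_imset// -[leqRHS]card_ord -cardsT.
    by rewrite proper_card// properT.
  - by rewrite imset_eq0.
  - rewrite big_imset//= -[RHS](vT A An) big_mkcond; apply: eq_bigr => i _.
    by rewrite !mxE; case: ifP => _; rewrite ?mulr1n// mulr0n mul0r.
have rkpow : (\rank (khatri_rao_pow X n) < #|S|)%N.
  rewrite ltn_neqAle rank_leq_row andbT; apply/negP => free.
  have := row_free_inj free (_ : e *m _ = 0 *m _); rewrite e_pow mul0mx.
  move=> /(_ erefl)/rowP/(_ (Ordinal S0)); rewrite !mxE => /eqP.
  exact/negP/c0.
have := khatri_rao_pow_rank S0 (leq_trans K0 rkX) cX.
move=> lt1; rewrite addn2 (leq_trans _ rkpow)// ltnS (leq_trans _ lt1)// ltnS.
by rewrite leq_mul2l -!subn1 leq_sub2r ?orbT.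
Qed.

Lemma vanishingD (S S' : {set E}) :
  S' \subset S -> vanishing S -> vanishing S' -> vanishing (S :\: S').
Proof.
move=> S'S vS vS' A An; have := vS A An; rewrite (big_setID S') /=.
by rewrite (finset.setIidPr S'S) vS'// add0r.
Qed.
End Vanishing.

(** Such a [K] meets [L] in [minn k #|L|] elements. For small [L] it is the complement of a set
    drawn from [~: L]. *)
Lemma card_comparable_subset (T : finType) (L : {set T}) k : (k <= #|T|)%N ->
  exists2 K : {set T}, #|K| = k & (K \subset L) || (L \subset K).
Proof.
have draw (B : {set T}) j : (j <= #|B|)%N ->
    exists2 K : {set T}, #|K| = j & K \subset B.
  rewrite -bin_gt0 -cards_draws => /card_gt0P[K].
  by rewrite inE => /andP[KB /eqP Kj]; exists K.
have [/draw[K Kk KL] _|kL kT] := leqP k #|L|; first by exists K; rewrite ?KL.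
have [|K Kk KL] := draw (~: L) (#|T| - k)%N.
  by have := cardsC L; lia.
exists (~: K); last by rewrite [L \subset _]finset.subsetC KL orbT.
by have := cardsC K; lia.
Qed.

(** * Counting the two sides of a vanishing sum *)

Section Kruskal.
Variables (F : fieldType) (I : Type) (m m' k n : nat).
Variables (x : 'I_m + 'I_m' -> I -> F) (c : 'I_m + 'I_m' -> F) (t1 : I).
Hypothesis c_neq0 : forall a, c a != 0.
Hypothesis x_t1 : forall a, x a t1 = 1.
Hypothesis k_gt0 : (0 < k)%N.
Hypothesis k_le : (k <= m)%N.
Hypothesis card_le : (2 * m - 1 <= (k - 1) * n)%N.
Hypothesis indep : forall K : {set 'I_m}, #|K| = k ->
  forall f : 'I_m -> F, (forall t, \sum_(i in K) f i * x (inl i) t = 0) ->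
  forall i, i \in K -> f i = 0.

Let E : finType := ('I_m + 'I_m')%type.
Let lefts (S : {set E}) : {set 'I_m} := finset (fun i => inl i \in S).
Let rights (S : {set E}) : {set 'I_m'} := finset (fun i => inr i \in S).

Let card_sides (S : {set E}) : #|S| = (#|lefts S| + #|rights S|)%N.
Proof.
rewrite -!sum1_card [LHS]big_mkcond big_sumType /= -!big_mkcond /=.
by congr (_ + _)%N; apply: eq_bigl => i; rewrite inE.
Qed.

Let lefts_indep (S : {set E}) (K0 : {set 'I_m}) : #|K0| = k ->
  independent_on x (finset.imset inl (mem (K0 :&: lefts S))).
Proof.
move=> K0k f fx a /imsetP[i]; rewrite inE => /andP[iK0 iL] ->.
pose g j := if j \in lefts S then f (inl j) else 0.
have -> : f (inl i) = g i by rewrite /g iL.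
apply: (indep K0k) => // t; rewrite -[RHS](fx t) big_imset /=; last first.
  by move=> u v _ _ [].
rewrite [LHS]big_mkcond [RHS]big_mkcond /=; apply: eq_bigr => j _.
by rewrite inE /g; case: (j \in K0); case: (j \in lefts S); rewrite ?mul0r.
Qed.

Lemma minimal_vanishing_balanced (S : {set E}) :
  vanishing x c n S -> S != finset.set0 ->
  (forall S' : {set E}, S' \proper S -> S' != finset.set0 -> ~ vanishing x c n S') ->
  (#|rights S| <= #|lefts S|)%N ->
  #|lefts S| = #|rights S| /\
  exists i j, S = finset.setU (finset.set1 (inl i)) (finset.set1 (inr j)).
Proof.
move=> vS S0 minS rl.
have S_gt0 : (0 < #|S|)%N by rewrite card_gt0.
have [|K0 K0k cmp] := @card_comparable_subset _ (lefts S) k; first by rewrite card_ord.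
pose K : {set E} := finset.imset inl (mem (K0 :&: lefts S)).
have cK : #|K| = #|K0 :&: lefts S| by rewrite card_imset// => u v [].
have l_gt0 : (0 < #|lefts S|)%N by move: S_gt0; rewrite card_sides; lia.
have lm : (#|lefts S| <= m)%N by rewrite -[leqRHS]card_ord max_card.
have KS : K \subset S.
  by apply/fintype.subsetP => _ /imsetP[i + ->]; rewrite !inE => /andP[].
have K_gt0 : (0 < #|K|)%N.
  rewrite cK; case/orP: cmp => [/finset.setIidPl ->|/finset.setIidPr ->//].
  by rewrite K0k.
have := minimal_vanishing_card vS minS c_neq0 KS K_gt0 (lefts_indep K0k).
rewrite cK card_sides; case/orP: cmp => [/finset.setIidPl ->|/finset.setIidPr ->].
  (* Here [k <= #|lefts S|], and the bound gives [(k - 1) * n + 2 <= 2 * m], against [card_le]. *)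
  rewrite K0k; nia.
move=> bound.
have [l1 r1] : #|lefts S| = 1%N /\ #|rights S| = 1%N.
  (* Since [k <= m], [card_le] yields [2 * m - 1 <= (m - 1) * n], which excludes [n <= 2]. With [l]
     elements on the left, [n * (l - 1) + 2 <= 2 * l] then leaves only [l = 1]. *)
  have n3 : (3 <= n)%N by nia.
  have l1 : #|lefts S| = 1%N by nia.
  by split=> //; lia.
have /eqP/cards1P[i li] := l1; have /eqP/cards1P[j rj] := r1.
split; first by rewrite l1.
exists i, j; apply/setP => -[u|u].
  have := finset.in_set1 u i; rewrite -li !inE => ->.
  by rewrite orbF.
by have := finset.in_set1 u j; rewrite -rj !inE => ->.
Qed.

(** Induction on the size of [S], cutting off vanishing subsums. No linearity is asked of [g]: the
    minimal pieces of a balanced sum are pairs with equal functions and opposite coefficients, where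
    any function of [x a] cancels. *)
Lemma vanishing_sides (S : {set E}) : vanishing x c n S ->
  (#|lefts S| <= #|rights S|)%N /\
  ((#|rights S| <= #|lefts S|)%N ->
    forall g : (I -> F) -> F, \sum_(a in S) c a * g (x a) = 0).
Proof.
have [r Sr] : exists r, (#|S| <= r)%N by exists #|S|.
elim: r S Sr => [|r IHr] S Sr vS.
  have := card_sides S; move: Sr; rewrite leqn0 cards_eq0 => /eqP -> /esym/eqP.
  rewrite cards0 addn_eq0 => /andP[/eqP -> /eqP ->]; split=> // _ g.
  by rewrite finset.big_set0.
have [->|S0] := eqVneq S finset.set0.
  by apply: IHr => [|A _]; rewrite ?cards0// finset.big_set0.
have [[S' [S'S S'0 vS']]|minS] := pselect (exists S' : {set E},
    [/\ S' \proper S, S' != finset.set0 & vanishing x c n S']).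
  have S'sub := proper_sub S'S.
  have cS' : (#|S'| <= r)%N by have := proper_card S'S; lia.
  have S'gt0 : (0 < #|S'|)%N by rewrite card_gt0.
  have cD : (#|S :\: S'| <= r)%N.
    by have := cardsID S' S; rewrite (finset.setIidPr S'sub); lia.
  have [l1 g1] := IHr _ cS' vS'.
  have [l2 g2] := IHr _ cD (vanishingD S'sub vS vS').
  have splitl : #|lefts S| = (#|lefts S'| + #|lefts (S :\: S')|)%N.
    rewrite -(cardsID (lefts S') (lefts S)); congr (_ + _)%N; apply: eq_card => i.
      by rewrite !inE andb_idl// => /(fintype.subsetP S'sub).
    by rewrite !inE.
  have splitr : #|rights S| = (#|rights S'| + #|rights (S :\: S')|)%N.
    rewrite -(cardsID (rights S') (rights S)); congr (_ + _)%N; apply: eq_card => i.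
      by rewrite !inE andb_idl// => /(fintype.subsetP S'sub).
    by rewrite !inE.
  rewrite splitl splitr; split; first exact: leq_add.
  (* Neither piece has more left than right elements, so balance of the whole forces balance of
     each. *)
  move=> le g; rewrite (big_setID S') /= (finset.setIidPr S'sub).
  by rewrite g1 ?g2 ?addr0//; lia.
have {}minS (S' : {set E}) : S' \proper S -> S' != finset.set0 -> ~ vanishing x c n S'.
  by move=> S'S S'0 vS'; apply: minS; exists S'.
have [lr|rl] := leqP #|lefts S| #|rights S|; last first.
  by have [lr _] := minimal_vanishing_balanced vS S0 minS (ltnW rl); lia.
split=> // rl g; have [_ [i [j SE]]] := minimal_vanishing_balanced vS S0 minS rl.
have pair (h : E -> F) : \sum_(a in S) h a = h (inl i) + h (inr j).
  by rewrite SE big_setU1 ?big_set1//= inE.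
(* All functions are 1 at [t1]: padding with [t1] compares the coefficients first, then, with one
   free argument, the functions. *)
have prod_t1 a r' : \prod_(t <- nseq r' t1) x a t = 1.
  by elim: r' => [|r' IH]; rewrite /= ?big_nil// big_cons x_t1 IH mulr1.
have cc : c (inl i) + c (inr j) = 0.
  rewrite -[RHS](vS (nseq n t1)) ?size_nseq// pair.
  by rewrite !prod_t1 !mulr1.
have xx : x (inl i) = x (inr j).
  apply/funext => t; have n_gt0 : (0 < n)%N by nia.
  have := vS (t :: nseq n.-1 t1); rewrite /= size_nseq prednK// => /(_ erefl).
  rewrite pair !big_cons !prod_t1 !mulr1 (_ : c (inr j) = - c (inl i)); last first.
    by apply/eqP; rewrite -addr_eq0 addrC cc.
  rewrite mulNr -mulrBr => /eqP; rewrite mulf_eq0 (negPf (c_neq0 _)) /=.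
  by rewrite subr_eq0 => /eqP.
by rewrite pair xx -mulrDl cc mul0r.
Qed.
End Kruskal.

(** * Probability measures as functions on events *)

Section Evaluation.
Context {R : realType} {d : measure_display} {T : measurableType d}.

Definition event := {B : set T | measurable B}.

Definition event_prob (mu : prob_measure T R) (B : event) : R :=
  fine (mu (sval B)).

Lemma event_probE (mu : prob_measure T R) (B : event) : mu (sval B) = (event_prob mu B)%:E.
Proof. by rewrite /event_prob fineK// fin_num_measure//; exact: (svalP B). Qed.

Lemma event_prob_inj : injective event_prob.
Proof.
move=> mu nu munu; apply/prob_measureP => B mB.
by rewrite -[B]/(sval (exist measurable B mB)) !event_probE munu.
Qed.

Lemma signed_measure_sumE (J : finType) (c : J -> R)
    (mu : J -> signed_measure T R) (B : set T) :
  (\sum_j c j *: mu j : signed_measure T R) B = \sum_j c j * mu j B.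
Proof. by elim/big_rec2: _ => // j u r _ <-. Qed.

(** Values on rectangles are the sums of products occurring in [vanishing]; [tT] serves as default
    value of [nth]. *)
Lemma V_rectangle n m (P : mixture R T m) (A : seq event) (tT : event) :
  size A = n ->
  V n P [set t : n.-tuple T | forall i : 'I_n, sval (nth tT A i) (tnth t i)]%classic =
  (\sum_i mixture_weights P i * \prod_(t <- A) event_prob (component P i) t)%:E.
Proof.
move=> An; rewrite /V /= /wsum -sumEFin; apply: eq_bigr => i _.
rewrite (@power_prob_rectangle _ _ _ (component P i) n
  (fun j => sval (nth tT A j))); last by move=> j; exact: (svalP (nth tT A j)).
rewrite EFinM; congr (_ * _)%E; rewrite (big_nth tT) big_mkord An -prodEFin.
by apply: eq_bigr => j _; rewrite event_probE.
Qed.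

Lemma measurable_rectangle n (A : 'I_n -> set T) :
  (forall i, measurable (A i)) ->
  measurable [set t : n.-tuple T | forall i, A i (tnth t i)]%classic.
Proof.
move=> mA; rewrite (_ : mkset _ =
    (\bigcap_(i in [set: 'I_n]) (@tnth _ T ^~ i) @^-1` A i)%classic); last first.
  by apply/seteqP; split => t /= H i => [_|]; exact: H.
apply: fin_bigcap_measurable => // i _.
by rewrite -[X in measurable X]setTI; apply: measurable_tnth => //; exact: mA.
Qed.

(** The increasing enumeration of [K] is one of the subsequences in [k_independent]; [k] is replaced
    by [#|K|] to give [enum_val] the required type. *)
Lemma k_independent_set k m (mu : 'I_m -> prob_measure T R) :
  k_independent k (fun i => signed_of_prob (mu i)) ->
  forall K : {set 'I_m}, #|K| = k ->
  forall f : 'I_m -> R, (forall B, \sum_(i in K) f i * event_prob (mu i) B = 0) ->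
  forall i, i \in K -> f i = 0.
Proof.
move=> ind K Kk f f0; subst k.
have smon : {homo @enum_val _ (mem K) : i j / (i < j)%N}.
  have ltT : transitive (relpre (@nat_of_ord m) ltn).
    by move=> j i l; exact: ltn_trans.
  have srt : sorted (relpre (@nat_of_ord m) ltn) (enum K).
    rewrite /enum_mem sorted_filter// -enumT -sorted_map val_enum_ord.
    exact: iota_ltn_sorted.
  move=> i j ij; have i0 := enum_val i; rewrite !(enum_val_nth i0).
  by apply: (sorted_ltn_nth ltT i0 srt); rewrite ?inE -?cardE.
move=> i iK; rewrite -(enum_rankK_in iK iK).
apply: (ind _ smon (fun j => f (enum_val j))); apply/signed_measureP => B mB.
rewrite signed_measure_sumE -[RHS](f0 (exist _ B mB)) [RHS]big_enum_val.
by [].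
Qed.

Lemma mixture_measureE m (P : mixture R T m) (B : set (prob_measure T R)) :
  mixture_measure P B =
  (\sum_i mixture_weights P i * (component P i \in B)%:R)%:E.
Proof.
by rewrite /mixture_measure /= /wsum -sumEFin; apply: eq_bigr.
Qed.
End Evaluation.

Theorem theorem4p1 (R : realType) (d : measure_display) (T : measurableType d)
    (m k n : nat) (hm : (2 <= m)%N) (hk : (0 < k)%N) (hn : (0 < n)%N)
    (hkm : (k <= m)%N) (P : mixture R T m)
    (hind : k_independent k (fun i : 'I_m => signed_of_prob (component P i)))
    (hmkn : (2 * m - 1 <= (k - 1) * n)%N) :
  identifiable n P.
Proof.
move=> [m' [P' [m'm + VPP']]]; apply.
(* Both mixtures form one signed family, [P] on the left and [P'] with negated weights on the right,
   whose total sum vanishes on rectangles. *)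
pose z (a : 'I_m + 'I_m') :=
  match a with inl i => component P i | inr j => component P' j end.
pose x a := event_prob (z a).
pose c (a : 'I_m + 'I_m') :=
  match a with inl i => mixture_weights P i | inr j => - mixture_weights P' j end.
pose tT : @event _ T := exist _ setT measurableT.
have c0 a : c a != 0.
  by case: a => i; rewrite /c ?oppr_eq0 gt_eqF// weight_gt0.
have x1 a : x a tT = 1 by rewrite /x /event_prob /= probability_setT.
have vT : vanishing x c n [set: 'I_m + 'I_m'].
  move=> A An; rewrite (eq_bigl predT); last by move=> a; rewrite inE.
  rewrite big_sumType /=; under [X in _ + X]eq_bigr do rewrite mulNr.
  rewrite sumrN; apply/eqP; rewrite subr_eq0; apply/eqP/EFin_inj.
  rewrite -!(V_rectangle _ tT An) VPP'//.
  apply: (@measurable_rectangle _ _ n (fun i => sval (nth tT A i))) => i.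
  exact: (svalP (nth tT A i)).
have [_ balanced] := vanishing_sides c0 x1 hk hkm hmkn (k_independent_set hind)
  vT.
apply/funext => B; rewrite !mixture_measureE; congr EFin; apply/esym/eqP.
(* By [event_prob_inj], [g] reads off from the function on events whether the measure lies in
   [B]. *)
pose g (f : @event _ T -> R) : R := `[< exists2 mu, mu \in B & event_prob mu = f >]%:R.
have gE a : g (x a) = (z a \in B)%:R.
  rewrite /g; congr (_%:R); congr nat_of_bool; apply/asboolP/idP => [[mu muB]|zB].
    by move/event_prob_inj <-.
  by exists (z a).
(* The whole sum has [m'] right and [m] left elements, and [m' <= m], so [balanced] applies. *)
rewrite -subr_eq0 -[eqbRHS](balanced _ g); last first.
  rewrite (leq_trans (max_card _))// card_ord [leqRHS](_ : _ = m)//.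
  by rewrite -[RHS]card_ord; apply: eq_card => i; rewrite !inE.
rewrite [eqbRHS](eq_bigl predT); last by move=> a; rewrite inE.
rewrite big_sumType /= -sumrN; apply/eqP; congr (_ + _); apply: eq_bigr => i _.
  by rewrite gE.
by rewrite gE mulNr.
Qed.
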